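(* Let $P:\mathbb{R}^n\to\mathbb{R}$ be a homogeneous real polynomial of degree $k$ that is symmetric and hyperbolic with respect to $\mathbf{1}=(1,\dots,1)$, with hyperbolicity cone $\Gamma(P)$ with respect to $\mathbf{1}$. Let $A=(a_{ij})$ be an $n\times n$ normal (complex) matrix with eigenvalues $\lambda(A)=(\lambda_1(A),\dots,\lambda_n(A))$, and set $d(A)=(a_{11},\dots,a_{nn})$. If $\Re\lambda(A)\in\Gamma(P)$, then $$\Re d(A)\in\Gamma(P)\quad\text{and}\quad P(\Re d(A))\ge P(\Re\lambda(A)),$$ where $\Re$ of a vector is taken componentwise.
   Context: Eigenvalues are listed with multiplicity; the order is immaterial because $P$ is symmetric. A polynomial $P:\mathbb{R}^n\to\mathbb{R}$ is symmetric if $P(\sigma x)=P(x)$ for every permutation $\sigma$ of the coordinates and every $x\in\mathbb{R}^n$. A homogeneous real polynomial $P$ of degree $k$ on $\mathbb{R}^n$ is hyperbolic with respect to $a\in\mathbb{R}^n$ if $P(a)>0$ and, for every $x\in\mathbb{R}^n$, the univariate polynomial $t\mapsto P(ta+x)$ has only real zeros. In that case $P(ta+x)=P(a)\prod_{i=1}^k(t+\lambda_i(P;a,x))$ with real numbers $\lambda_i(P;a,x)$. The hyperbolicity cone is $\Gamma(P;a)=\{x\in\mathbb{R}^n:\lambda_i(P;a,x)>0\text{ for all }i=1,\dots,k\}$, and $\Gamma(P):=\Gamma(P;\mathbf{1})$. *)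

(* Defs.v *)
From mathcomp Require Export all_boot all_order all_algebra all_fingroup.
From mathcomp Require Export spectral reals.
From mathcomp Require Export complex mpoly.

Set Implicit Arguments.
Unset Strict Implicit.
Unset Printing Implicit Defensive.

Import Order.TTheory GRing.Theory Num.Theory.

Local Open Scope ring_scope.
Local Open Scope complex_scope.

(* Points of R^n are functions 'I_n -> R, the arguments of [meval] (P.@[x]). *)

Definition symmetric_poly (R : realType) (n : nat) (P : {mpoly R[n]}) : Prop :=
  forall (s : 'S_n) (x : 'I_n -> R), P.@[fun i => x (s i)] = P.@[x].

(* "t |-> P(ta + x) has only real zeros": every complex zero of the
   complexified polynomial has zero imaginary part. *)
Definition hyperbolic (R : realType) (n : nat) (P : {mpoly R[n]})
    (a : 'I_n -> R) : Prop :=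
  0 < P.@[a] /\
  forall (x : 'I_n -> R) (z : R[i]),
    (map_mpoly (real_complex R) P).@[fun i => z * (a i)%:C + (x i)%:C] = 0 ->
    complex.Im z = 0.

Definition hyp_eigenvalues (R : realType) (n k : nat) (P : {mpoly R[n]})
    (a x : 'I_n -> R) (lam : 'I_k -> R) : Prop :=
  forall t : R,
    P.@[fun i => t * a i + x i] = P.@[a] * \prod_(i < k) (t + lam i).

(* For P homogeneous of degree k and hyperbolic with respect to a, the family
   lam below exists for every x and is unique up to permutation, so the
   existential only names it. *)
Definition hyp_cone (R : realType) (n k : nat) (P : {mpoly R[n]})
    (a x : 'I_n -> R) : Prop :=
  exists2 lam : 'I_k -> R,
    hyp_eigenvalues P a x lam & forall i : 'I_k, 0 < lam i.

Definition ones (R : realType) (n : nat) : 'I_n -> R := fun=> 1.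

(* lam lists the eigenvalues of A with algebraic multiplicity. *)
Definition mx_eigenvalues (R : realType) (n : nat) (A : 'M[R[i]]_n)
    (lam : 'I_n -> R[i]) : Prop :=
  char_poly A = \prod_(i < n) ('X - (lam i)%:P).

(* Main.v *)
Require Import Defs.
From mathcomp Require Import boolp classical_sets.
From mathcomp Require Import ring lra zify.

(** Why the theorem holds.  By the spectral theorem a normal matrix is
    [A = U^* diag(lambda) U] with [U] unitary, so its diagonal is the image of
    [lambda] under the matrix of the [|U j i|^2], which is bistochastic
    ([normal_diagonal_bistochastic]).  As this matrix is real, the real parts
    satisfy the same relation.  By Birkhoff's theorem a bistochastic image of
    [y] is a convex combination of the vectors obtained by permuting the
    coordinates of [y] ([bistochastic_image_mem]).  Since [P] is symmetric, all
    permutations of [Re lambda] lie in the set [V] of the points [x] of the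
    hyperbolicity cone such that [P x >= P (Re lambda)].  It remains to see that
    [V] is convex, which is Garding's theory of hyperbolic polynomials
    ([superlevel_convex]).

    That theory rests on one continuity principle: when a polynomial [f_r] of
    constant degree depends continuously on [r], and no [f_r] with [r] in
    [[0, 1]] has a real root, roots cannot cross the real axis.  So, if all
    roots of [f_0] are in the lower half-plane, the same is true of [f_1]
    ([roots_stay_in_lower_half_plane]).  It is used twice.
    - For [b] in the cone, it shows that [P (t b + i e + x) <> 0] for real [x]
      and [Im t >= 0], by comparison with [x = 0].  Since the cone is open, [b]
      can be replaced by [b - eps e], and it follows that [P] does not vanish on
      the tube of the points [x + i b] ([tube_neq0]).  In particular [P] is
      hyperbolic with respect to [b].
    - For [x] and [y] in the cone, moving from [e] to [y] in the family
      [P (t x + i ((1 - r) e + r y))] shows that [P (s x + y) <> 0] for [s >= 0]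
      ([hyp_cone_segment_neq0]).  This gives the convexity of the cone, and also
      the factorization [P (s x + y) = P x * prod (s + mu_j)] with [mu_j > 0].

    Quasi-concavity of [P] on the cone is then the elementary fact that
    [prod mu_j >= 1] implies [prod (s + (1 - s) mu_j) >= 1]
    ([prod_affine_ge1]). *)

Set Implicit Arguments.
Unset Strict Implicit.
Unset Printing Implicit Defensive.

Import Order.TTheory GRing.Theory Num.Theory.
Import ComplexField.Normc.
Local Open Scope ring_scope.
Local Open Scope complex_scope.

(** * Restricting a homogeneous polynomial to a complex line *)

Lemma homog_scale (K : comNzRingType) (n k : nat) (Q : {mpoly K[n]})
    (c : K) (x y : 'I_n -> K) :
  Q \is k.-homog -> (forall i, y i = c * x i) -> Q.@[y] = c ^+ k * Q.@[x].
Proof.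
move=> /dhomogP Qh yE; rewrite !mevalE big_distrr /=; apply: eq_big_seq => m mQ.
under eq_bigr do rewrite yE exprMn.
by rewrite big_split /= prodrXr -mdegE (Qh _ mQ) mulrCA.
Qed.

Lemma homog_scale_neq0 (K : idomainType) (n k : nat) (Q : {mpoly K[n]})
    (c : K) (x y : 'I_n -> K) :
  Q \is k.-homog -> c != 0 -> (forall i, y i = c * x i) ->
  Q.@[x] != 0 -> Q.@[y] != 0.
Proof.
by move=> Q_homog c0 /(homog_scale Q_homog) -> Qx; rewrite mulf_neq0 // expf_neq0.
Qed.

Section TopCoefficient.
Variable K : comNzRingType.
Implicit Types (p q : {poly K}) (a b : K) (d : nat).

(** [d] only bounds the degree: [a] may vanish, which makes the notion stable
    under sums and products. *)
Definition top_coef d a p := (size p <= d.+1)%N /\ p`_d = a.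

Lemma top_coefM d1 d2 a1 a2 p1 p2 : top_coef d1 a1 p1 -> top_coef d2 a2 p2 ->
  top_coef (d1 + d2) (a1 * a2) (p1 * p2).
Proof.
move=> [s1 <-] [s2 <-]; split.
  by apply: leq_trans (size_polyMleq _ _) _; move: (leq_add s1 s2); lia.
have lt1 : (d1 < (d1 + d2).+1)%N by rewrite ltnS leq_addr.
rewrite coefM (bigD1 (Ordinal lt1)) //= addKn big1 ?addr0 // => i ne_i.
have {}ne_i : (i != d1 :> nat)%N by apply: contra ne_i => /eqP e; apply/eqP/val_inj.
case: (ltnP i d1) => id1.
  by rewrite [p2`__]nth_default ?mulr0 //; apply: leq_trans s2 _; lia.
rewrite nth_default ?mul0r //; apply: leq_trans s1 _; lia.
Qed.

Lemma top_coef_exp d a p j : top_coef d a p -> top_coef (d * j) (a ^+ j) (p ^+ j).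
Proof.
move=> pd; elim: j => [|j IHj]; last by rewrite mulnS !exprS; apply: top_coefM.
by rewrite muln0 !expr0; split; rewrite ?size_poly1 // coefC.
Qed.

Lemma top_coef_prod (I : Type) (r : seq I) (d : I -> nat) (a : I -> K)
    (p : I -> {poly K}) :
  (forall i, top_coef (d i) (a i) (p i)) ->
  top_coef (\sum_(i <- r) d i) (\prod_(i <- r) a i) (\prod_(i <- r) p i).
Proof.
move=> ap; elim: r => [|i r IHr]; last by rewrite !big_cons; apply: top_coefM.
by rewrite !big_nil; split; rewrite ?size_poly1 // coefC.
Qed.

Lemma top_coef_sum (I : eqType) (r : seq I) d (a : I -> K) (p : I -> {poly K}) :
  (forall i, i \in r -> top_coef d (a i) (p i)) ->
  top_coef d (\sum_(i <- r) a i) (\sum_(i <- r) p i).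
Proof.
elim: r => [|i r IHr] ap; first by rewrite !big_nil; split; rewrite ?size_poly0 ?coef0.
have [|ps pc] := ap i; first exact: mem_head.
have [|IHs IHc] := IHr; first by move=> j jr; apply: ap; rewrite inE jr orbT.
rewrite !big_cons; split; last by rewrite coefD pc IHc.
by apply: leq_trans (size_polyD _ _) _; rewrite geq_max ps.
Qed.

End TopCoefficient.

Lemma homog_line_poly (K : comNzRingType) (n k : nat) (Q : {mpoly K[n]})
    (b u : 'I_n -> K) : Q \is k.-homog ->
  exists2 q : {poly K}, top_coef k Q.@[b] q &
    forall t, q.[t] = Q.@[fun i => t * b i + u i].
Proof.
move=> /dhomogP Qh.
exists (\sum_(m <- msupp Q) Q@_m *: \prod_i (b i *: 'X + (u i)%:P) ^+ m i).
  rewrite mevalE; apply: top_coef_sum => m mQ.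
  have kE : k = (0 + \sum_i m i)%N by rewrite add0n -mdegE (Qh _ mQ).
  rewrite -mul_polyC kE; apply: top_coefM.
    by split; [rewrite size_polyC leq_b1 | rewrite coefC].
  apply: top_coef_prod => i.
  rewrite -[X in top_coef X]mul1n; apply: top_coef_exp; split.
    apply: leq_trans (size_polyD _ _) _; rewrite geq_max.
    rewrite (leq_trans (size_scale_leq _ _)) ?size_polyX //.
    by rewrite (leq_trans (size_polyC_leq1 _)).
  by rewrite coefD coefZ coefX coefC /= mulr1 addr0.
move=> t; rewrite mevalE horner_sum; apply: eq_bigr => m _.
rewrite hornerZ horner_prod; congr (_ * _); apply: eq_bigr => i _.
by rewrite horner_exp !hornerE mulrC.
Qed.

(** The number of factors is the degree of homogeneity because the coefficient
    of [t ^+ k] in [Q (t b + u)] is [Q b]. *)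
Lemma homog_line_factor (C : closedFieldType) (n k : nat) (Q : {mpoly C[n]})
    (b u : 'I_n -> C) : Q \is k.-homog -> Q.@[b] != 0 ->
  exists tau : 'I_k -> C,
    forall t, Q.@[fun i => t * b i + u i] = Q.@[b] * \prod_(j < k) (t - tau j).
Proof.
move=> Qh Qb; have [q [qs qk] qE] := homog_line_poly b u Qh.
have sq : size q = k.+1.
  by apply/eqP; rewrite eqn_leq qs ltnNge; apply: contra Qb => ?; rewrite -qk nth_default.
have [rs qrs] := closed_field_poly_normal q.
have lc : lead_coef q = Q.@[b] by rewrite lead_coefE sq.
have srs : size rs = k.
  by move: sq; rewrite qrs size_scale ?lc // size_prod_XsubC => -[].
exists (fun j => rs`_j) => t.
rewrite -qE qrs hornerZ lc horner_prod; congr (_ * _).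
rewrite (big_nth 0) srs big_mkord; apply: eq_bigr => j _.
by rewrite !hornerE.
Qed.

(** * Lipschitz estimates for complex polynomials *)

Section Confinement.
Variable R : realType.
Local Notation C := R[i].

Lemma normc_ge0 (z : C) : 0 <= normc z.
Proof. by case: z => a b; rewrite sqrtr_ge0. Qed.

Lemma normc_real (x : R) : normc x%:C = `|x|.
Proof. by rewrite /= expr0n addr0 sqrtr_sqr. Qed.

Lemma ler_normcD (z w : C) : normc (z + w) <= normc z + normc w.
Proof. exact: le_normcD. Qed.

Lemma normc_prod (I : Type) (r : seq I) (f : I -> C) :
  normc (\prod_(i <- r) f i) = \prod_(i <- r) normc (f i).
Proof.
by elim/big_rec2: _ => [|i x y _ <-]; rewrite ?normc1 ?normcM.
Qed.

Lemma normc_ge_Im (z : C) : `|complex.Im z| <= normc z.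
Proof.
by case: z => a b /=; rewrite -sqrtr_sqr ler_wsqrtr // lerDr sqr_ge0.
Qed.

Lemma Im_le_normcB (z w : C) : complex.Im z - complex.Im w <= normc (z - w).
Proof.
apply: le_trans (normc_ge_Im _); apply: le_trans (ler_norm _).
by case: z w => [a b] [c d].
Qed.

Section Lipschitz.
Variables (n : nat) (M : R).
Implicit Types (f g : ('I_n -> C) -> C) (x y : 'I_n -> C).

Definition in_ball x := forall i, normc (x i) <= M.

(** Boundedness is part of the notion because the product rule needs it. *)
Definition lipschitz f := exists2 L : R, 0 <= L &
  forall x, in_ball x -> normc (f x) <= L /\
    forall y d, in_ball y -> 0 <= d -> (forall i, normc (x i - y i) <= d) ->
    normc (f x - f y) <= L * d.

Lemma lipschitz_cst c : lipschitz (fun=> c).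
Proof.
exists (normc c) => [|x _]; first exact: normc_ge0.
split=> // y d _ d0 _; rewrite subrr normc0.
by rewrite mulr_ge0 ?normc_ge0.
Qed.

Lemma lipschitz_coord i : lipschitz (fun x => x i).
Proof.
exists (Num.max M 1) => [|x xM]; first by rewrite le_max ler01 orbT.
split=> [|y d yM d0 xy]; first by rewrite le_max xM.
by apply: le_trans (xy i) _; rewrite ler_peMl // le_max lexx orbT.
Qed.

Lemma lipschitzD f g : lipschitz f -> lipschitz g -> lipschitz (fun x => f x + g x).
Proof.
move=> [L L0 fL] [N N0 gN]; exists (L + N) => [|x xM]; first exact: addr_ge0.
have [[fx fxy] [gx gxy]] := (fL x xM, gN x xM); split=> [|y d yM d0 xy].
  by apply: le_trans (ler_normcD _ _) _; apply: lerD.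
have -> : f x + g x - (f y + g y) = (f x - f y) + (g x - g y) by ring.
apply: le_trans (ler_normcD _ _) _; rewrite mulrDl; apply: lerD; eauto.
Qed.

Lemma lipschitzM f g : lipschitz f -> lipschitz g -> lipschitz (fun x => f x * g x).
Proof.
move=> [L L0 fL] [N N0 gN]; exists (L * N + N * L) => [|x xM].
  by rewrite addr_ge0 // mulr_ge0.
have [[fx fxy] [gx gxy]] := (fL x xM, gN x xM); split=> [|y d yM d0 xy].
  rewrite normcM; apply: le_trans (ler_pM _ _ fx gx) _; rewrite ?normc_ge0 //.
  by rewrite lerDl mulr_ge0.
have -> : f x * g x - f y * g y = f x * (g x - g y) + g y * (f x - f y) by ring.
apply: le_trans (ler_normcD _ _) _.
rewrite !normcM mulrDl -!mulrA; apply: lerD; apply: ler_pM; rewrite ?normc_ge0 //.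
- exact: gxy.
- by have [] := gN y yM.
- exact: fxy.
Qed.

Lemma lipschitz_meval (Q : {mpoly C[n]}) : lipschitz (fun x => Q.@[x]).
Proof.
have eq_lip f g : f =1 g -> lipschitz f -> lipschitz g.
  move=> fg [L L0 fL]; exists L => // x /fL[fx fxy].
  by rewrite -fg; split=> // y d yM; rewrite -fg; apply: fxy.
apply: (eq_lip _ _ (fun x => esym (mevalE x Q))).
elim: (msupp Q : seq _) => [|m r IHr].
  by apply: eq_lip (lipschitz_cst 0) => x; rewrite big_nil.
apply: (eq_lip (fun x => Q@_m * \prod_(i < n) x i ^+ m i
  + \sum_(m <- r) Q@_m * \prod_(i < n) x i ^+ m i)).
  by move=> x; rewrite big_cons.
apply: lipschitzD => //; apply: lipschitzM; first exact: lipschitz_cst.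
elim: (index_enum _) => [|i s IHs].
  by apply: eq_lip (lipschitz_cst 1) => x; rewrite big_nil.
apply: (eq_lip (fun x => x i ^+ m i * \prod_(i <- s) x i ^+ m i)).
  by move=> x; rewrite big_cons.
apply: lipschitzM => //; elim: (m i) => [|j IHj].
  by apply: eq_lip (lipschitz_cst 1) => x; rewrite expr0.
apply: (eq_lip (fun x => x i * x i ^+ j)); first by move=> x; rewrite exprS.
by apply: lipschitzM IHj; apply: lipschitz_coord.
Qed.

End Lipschitz.

(** * Roots do not cross the real axis *)

(** Connectedness of the unit interval: the supremum of the [r] such that [good]
    holds on [[0, r]] can only be [1]. *)
Lemma locally_constant_on_unit_interval (good : R -> Prop) : good 0 ->
  (forall r, 0 <= r <= 1 -> exists2 e, 0 < e &
     forall r', 0 <= r' <= 1 -> `|r' - r| < e -> good r <-> good r') ->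
  good 1.
Proof.
move=> g0 loc.
pose S : set R := fun r => 0 <= r <= 1 /\ forall r', 0 <= r' <= r -> good r'.
have S0 : S 0.
  split; first by rewrite lexx ler01.
  by move=> r'; rewrite -eq_le => /eqP <-.
have hasS : has_sup S.
  by split; [exists 0 | exists 1 => r [/andP[]]].
have s0 : 0 <= sup S by apply: sup_upper_bound.
have s1 : sup S <= 1 by apply: ge_sup => [|r [/andP[]] //]; exists 0.
have [|e e0 near] := loc (sup S); first by rewrite s0.
have [r [/andP[r0 r1] rS] rs] := sup_adherent e0 hasS.
have rle : r <= sup S by apply: sup_upper_bound => //; split; rewrite ?r0.
have gs : good (sup S).
  apply/(near r); rewrite ?r0 //; last by apply: rS; rewrite r0 lexx.
  by rewrite distrC ger0_norm ?subr_ge0 // ltrBlDr -ltrBlDl.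
(* As [good] is locally constant, it holds a little beyond the supremum. *)
have St : S (Num.min 1 (sup S + e / 2)).
  split; first by rewrite le_min ler01 ge_min lexx /= addr_ge0 // divr_ge0 // ltW.
  move=> r' /andP[r'0]; rewrite le_min => /andP[r'1 r's].
  have [le_r|lt_r] := leP r' r; first by apply: rS; rewrite r'0.
  apply/(near r') => //; first by rewrite r'0.
  by rewrite ltr_norml; apply/andP; split; lra.
have := sup_upper_bound hasS St; rewrite ge_min => /orP[s1'|]; last by lra.
by have -> : 1 = sup S by lra.
Qed.

(** A point [t] of the closed upper half-plane is at distance at least [- Im tau]
    of [tau] and at least [|t| - |tau|]; a combination of the two bounds grows
    like [1 + |t|]. *)
Lemma lower_half_plane_dist (t tau : C) : 0 <= complex.Im t -> complex.Im tau < 0 ->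
  - complex.Im tau / (1 + normc tau - complex.Im tau) * (1 + normc t) <= normc (t - tau).
Proof.
move=> t0 tau0; have tau_ge := normc_ge0 tau.
rewrite mulrAC ler_pdivrMr; last by lra.
have d1 : - complex.Im tau <= normc (t - tau) by have := Im_le_normcB t tau; lra.
have d2 : normc t <= normc (t - tau) + normc tau.
  by rewrite -{1}[t](subrK tau) ler_normcD.
have : 0 <= normc (t - tau) + complex.Im tau by lra.
have := normc_ge0 (t - tau); nra.
Qed.

Section HalfPlane.
Variables (n k : nat) (Q : {mpoly C[n]}) (b u v : 'I_n -> C).
Hypotheses (Q_homog : Q \is k.-homog) (Qb : Q.@[b] != 0).

Let f (r : R) (t : C) := Q.@[fun i => t * b i + (u i + r%:C * v i)].

(** By homogeneity, dividing the arguments by [1 + |t|] brings them into a fixed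
    ball, where the polynomial is Lipschitz. *)
Lemma line_family_lipschitz : exists2 K : R, 0 < K &
  forall r r' t, 0 <= r <= 1 -> 0 <= r' <= 1 ->
    normc (f r t - f r' t) <= K * `|r - r'| * (1 + normc t) ^+ k.
Proof.
pose M := \sum_i (normc (b i) + (normc (u i) + normc (v i))).
have Mi i : normc (b i) + (normc (u i) + normc (v i)) <= M.
  by rewrite /M (bigD1 i) //= lerDl sumr_ge0 // => j _; rewrite !addr_ge0 ?normc_ge0.
have M0 : 0 <= M by rewrite sumr_ge0 // => j _; rewrite !addr_ge0 ?normc_ge0.
have [L L0 QL] := lipschitz_meval M Q.
exists (L * M + 1) => [|r r' t r01 r'01]; first by rewrite ltr_wpDl // mulr_ge0.
pose N : R := 1 + normc t; have N1 : 1 <= N by rewrite lerDl normc_ge0.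
have N0 : 0 < N by lra.
have NC0 : N%:C != 0 by rewrite eq_complex /= negb_and gt_eqF.
pose w (s : R) i := N%:C^-1 * (t * b i + (u i + s%:C * v i)).
have fE s : f s t = N%:C ^+ k * Q.@[w s].
  by apply: homog_scale Q_homog _ => i; rewrite mulVKf.
have normN : normc N%:C^-1 = N^-1 by rewrite normcV normc_real gtr0_norm.
have wM s : 0 <= s <= 1 -> in_ball M (w s).
  move=> /andP[s0 s1] i; rewrite normcM normN mulrC ler_pdivrMr //.
  apply: le_trans (ler_normcD _ _) _.
  have := ler_normcD (u i) (s%:C * v i).
  rewrite !normcM normc_real ger0_norm //.
  have := Mi i; have := normc_ge0 (b i); have := normc_ge0 (u i).
  have := normc_ge0 (v i); have := normc_ge0 t; rewrite /N; nra.
have [_ QLip] := QL _ (wM r r01).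
rewrite !fE -mulrBr normcM mulrC.
have -> : normc (N%:C ^+ k) = N ^+ k.
  elim: (k) => [|j IHj]; first by rewrite !expr0 normc1.
  by rewrite !exprS normcM IHj normc_real gtr0_norm.
apply: ler_wpM2r; first by rewrite exprn_ge0 // ltW.
apply: le_trans (QLip _ (`|r - r'| * M) (wM r' r'01) _ _) _.
- by rewrite mulr_ge0.
- move=> i; have -> : w r i - w r' i = N%:C^-1 * ((r - r')%:C * v i).
    by rewrite /w rmorphB /=; ring.
  rewrite !normcM normN normc_real mulrC ler_pdivrMr //.
  rewrite -mulrA ler_wpM2l // (@le_trans _ _ M) ?ler_peMr //.
  by have := Mi i; have := normc_ge0 (b i); have := normc_ge0 (u i); lra.
- by rewrite mulrDl mul1r mulrAC -mulrA lerDl.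
Qed.

(** Having all roots in the lower half-plane is a locally constant property of
    [r].  If it holds at [r], then [|f r t|] is at least a multiple of
    [(1 + |t|) ^+ k] on the upper half-plane, so small changes of [r] create no
    root there.  If it fails at [r], there is a root [t] with [Im t > 0]; were
    it to hold at a nearby [r'], all the factors of [f r' t] would have modulus
    at least [Im t], which contradicts the smallness of [f r' t]. *)
Lemma roots_stay_in_lower_half_plane :
  (forall r x : R, 0 <= r <= 1 -> f r x%:C != 0) ->
  (forall t, 0 <= complex.Im t -> f 0 t != 0) ->
  forall t, 0 <= complex.Im t -> f 1 t != 0.
Proof.
move=> noreal f0; pose good r := forall t, 0 <= complex.Im t -> f r t != 0.
apply: (@locally_constant_on_unit_interval good) => // r r01.
have [K K0 fK] := line_family_lipschitz.
have Qb0 : 0 < normc Q.@[b].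
  by rewrite lt_def normc_ge0 andbT; apply: contra Qb => /eqP/eq0_normc ->.
have factor s : good s -> exists2 tau : 'I_k -> C,
    forall j, complex.Im (tau j) < 0 &
    forall t, f s t = Q.@[b] * \prod_j (t - tau j).
  move=> gs; have [tau tauE] := homog_line_factor (fun i => u i + s%:C * v i) Q_homog Qb.
  exists tau => // j; rewrite ltNge; apply/negP => /gs.
  by rewrite /f tauE (bigD1 j) //= subrr mul0r mulr0 eqxx.
have [gr|bad] := EM (good r).
  have [tau tau_lt fE] := factor r gr.
  pose kappa := normc Q.@[b] *
    \prod_j (- complex.Im (tau j) / (1 + normc (tau j) - complex.Im (tau j))).
  have delta0 j : 0 < - complex.Im (tau j) / (1 + normc (tau j) - complex.Im (tau j)).
    have := tau_lt j; have := normc_ge0 (tau j) => ? ?.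
    by rewrite divr_gt0 //; lra.
  have kappa0 : 0 < kappa by rewrite mulr_gt0 // prodr_gt0.
  exists (kappa / K) => [|r' r'01 rr']; first exact: divr_gt0.
  split=> [_ t t0|_]; last exact: gr.
  apply/eqP => fr't.
  have := fK r r' t r01 r'01; rewrite fr't subr0 leNgt => /negP; apply.
  have N0 : 0 < (1 + normc t) ^+ k by rewrite exprn_gt0 // ltr_pwDl // normc_ge0.
  apply: (@lt_le_trans _ _ (kappa * (1 + normc t) ^+ k)).
    by rewrite ltr_pM2r // distrC mulrC -ltr_pdivlMr.
  rewrite fE normcM normc_prod /kappa -mulrA ler_pM2l //.
  rewrite -[k in _ ^+ k]card_ord -prodr_const -big_split /=.
  apply: ler_prod => j _; rewrite lower_half_plane_dist // andbT.
  by rewrite mulr_ge0 ?(ltW (delta0 j)) // addr_ge0 ?normc_ge0.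
have /existsNP[t /not_implyP[t0 /negP/negPn/eqP frt]] := bad.
have {}t0 : 0 < complex.Im t.
  rewrite lt_def t0 andbT; apply/negP => /eqP Imt.
  have := noreal r (complex.Re t) r01; suff -> : (complex.Re t)%:C = t by rewrite frt eqxx.
  by case: t Imt {t0 frt} => x y /= ->.
have N0 : 0 < (1 + normc t) ^+ k by rewrite exprn_gt0 // ltr_pwDl // normc_ge0.
exists (normc Q.@[b] * complex.Im t ^+ k / (K * (1 + normc t) ^+ k)).
  exact: divr_gt0 (mulr_gt0 Qb0 (exprn_gt0 k t0)) (mulr_gt0 K0 N0).
move=> r' r'01; rewrite (ltr_pdivlMr _ _ (mulr_gt0 K0 N0)) => rr'.
split=> [/bad []|/factor[tau tau_lt fE]]; exfalso.
have := fK r' r t r'01 r01; rewrite frt subr0 leNgt => /negP; apply.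
apply: (@lt_le_trans _ _ (normc Q.@[b] * complex.Im t ^+ k)).
  by rewrite mulrAC mulrC.
rewrite fE normcM normc_prod (ler_pM2l Qb0) -[k in _ ^+ k]card_ord -prodr_const.
apply: ler_prod => j _; rewrite (ltW t0) /=.
by have := Im_le_normcB t (tau j); have := tau_lt j; lra.
Qed.

End HalfPlane.

End Confinement.

(** * An inequality for products *)

(** Smoothing: as long as some entry [a] is below [1], another entry [b] is above
    [1], and replacing the two by [1] and [a * b] keeps the product of the [m]
    and can only decrease the product of the [s + t * m]. *)
Lemma prod_affine_ge1 (R : realFieldType) (s t : R) (mu : seq R) :
  0 <= s -> 0 <= t -> s + t = 1 -> all (> 0) mu -> 1 <= \prod_(m <- mu) m ->
  1 <= \prod_(m <- mu) (s + t * m).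
Proof.
move=> s0 t0 st; have [j] := ubnP (size mu); elim: j mu => // j IHj mu ltj mu0 mu1.
have [ge1|] := boolP (all (>= 1) mu).
  elim: (mu) ge1 => [|m l IHl] /=; rewrite ?big_nil // big_cons => /andP[m1 /IHl].
  by apply: mulr_ege1; nra.
rewrite -has_predC => /hasP[a amu /=]; rewrite -ltNge => a1.
have mu_a := perm_to_rem amu.
have a0 : 0 < a by apply: (allP mu0).
move: mu0 mu1 ltj; rewrite (perm_all _ mu_a) !(perm_big _ mu_a) (perm_size mu_a) /=.
move: (rem a mu) => l {mu_a amu mu}; rewrite a0 !big_cons /= => l0 l1 ltj.
have [le1|] := boolP (all (<= 1) l).
  suff : \prod_(m <- l) m <= 1.
    move=> ll; have : a * \prod_(m <- l) m <= a by rewrite ger_pMr.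
    by move=> al; lra.
  elim: (l) l0 le1 => [|m r IHr] /=; rewrite ?big_nil // big_cons.
  move=> /andP[m0 r0] /andP[m1 r1]; rewrite mulr_ile1 ?IHr ?(ltW m0) //.
  by rewrite big_seq prodr_ge0 // => i /(allP r0) /ltW.
rewrite -has_predC => /hasP[b bl /=]; rewrite -ltNge => b1.
have l_b := perm_to_rem bl.
move: l0 l1 ltj; rewrite (perm_all _ l_b) !(perm_big _ l_b) (perm_size l_b) /=.
move: (rem b l) => r {l_b bl l}; rewrite !big_cons /= => /andP[b0 r0] r1 ltj.
have := IHj (a * b :: r); rewrite /= !big_cons -mulrA => /(_ ltj).
rewrite mulr_gt0 // r0 => /(_ isT r1) /le_trans; apply; rewrite mulrA.
apply: ler_wpM2r.
  by rewrite big_seq prodr_ge0 // => i /(allP r0) /= ?; nra.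
(* The loss in replacing [(a, b)] by [(1, a * b)] is [s * t * (1 - a) * (b - 1)]. *)
have -> : s = 1 - t by lra.
have t1 : t <= 1 by lra.
have : 0 <= t * (1 - t) * ((1 - a) * (b - 1)).
  by rewrite !mulr_ge0 // ?subr_ge0 // ltW.
by lra.
Qed.

(** * Hyperbolicity cones *)

Section Hyperbolic.
Variables (R : realType) (n k : nat) (P : {mpoly R[n]}).
Hypothesis P_homog : P \is k.-homog.
Local Notation C := R[i].
Implicit Types (a x y : 'I_n -> R).

Let Pc : {mpoly C[n]} := map_mpoly (real_complex R) P.

Lemma complexification_homog : Pc \is k.-homog.
Proof.
apply/dhomogP => m; rewrite mcoeff_msupp mcoeff_map_mpoly => Pm.
apply: (dhomogP _ _ _ P_homog); rewrite mcoeff_msupp.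
by apply: contra Pm => /eqP ->; apply/eqP.
Qed.

Lemma complexification_real x : Pc.@[fun i => (x i)%:C] = (P.@[x])%:C.
Proof.
rewrite /Pc {1}[P]mpolyE (raddf_sum (map_mpoly (real_complex R))).
rewrite (raddf_sum (meval _)) mevalE (rmorph_sum (real_complex R)) /=.
apply: eq_bigr => m _; rewrite map_mpolyZ map_mpolyX mevalZ mevalX.
rewrite (rmorphM (real_complex R)) (rmorph_prod (real_complex R)); congr (_ * _).
by apply: eq_bigr => i _; rewrite (rmorphXn (real_complex R)).
Qed.

Lemma hyp_eigenvalues_exist a x : hyperbolic P a ->
  exists lam : 'I_k -> R, hyp_eigenvalues P a x lam.
Proof.
move=> [Pa rr]; have Pa0 : Pc.@[fun i => (a i)%:C] != 0.
  by rewrite complexification_real; apply/eqP => -[] /eqP; rewrite gt_eqF.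
have [tau tauE] := homog_line_factor (fun i => (x i)%:C) complexification_homog Pa0.
have tau_real j : tau j = (complex.Re (tau j))%:C.
  have : complex.Im (tau j) = 0.
    by apply: (rr x); rewrite -/Pc tauE (bigD1 j) //= subrr mul0r mulr0.
  by case: (tau j) => u v /= ->.
exists (fun j => - complex.Re (tau j)) => t; apply: (@complexI R).
rewrite (rmorphM (real_complex R)) /= -!complexification_real.
rewrite (rmorph_prod (real_complex R)) /=.
transitivity (Pc.@[fun i => t%:C * (a i)%:C + (x i)%:C]).
  by congr (_.@[_]); apply/funext => i; rewrite rmorphD rmorphM.
rewrite tauE; congr (_ * _); apply: eq_bigr => j _.
by rewrite {1}tau_real rmorphB.
Qed.

(** The cone is cut out by the non-vanishing of [P] on half-lines, a form that
    combines well with the root confinement principle. *)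
Lemma hyp_coneP a x : hyperbolic P a ->
  hyp_cone k P a x <-> forall t, 0 <= t -> P.@[fun i => t * a i + x i] != 0.
Proof.
move=> Pa; split=> [[lam lamE lam0] t t0 | nz].
  rewrite lamE mulf_neq0 ?gt_eqF ?Pa.1 //.
  by rewrite prodr_gt0 // => j _; apply: ltr_wpDl.
have [lam lamE] := hyp_eigenvalues_exist x Pa; exists lam => // j.
rewrite ltNge; apply/negP => lam0.
suff : P.@[fun i => - lam j * a i + x i] == 0 by apply/negP/nz; rewrite oppr_ge0.
by rewrite lamE (bigD1 j) //= addNr mul0r mulr0.
Qed.

Lemma hyp_cone_gt0 a x : hyperbolic P a -> hyp_cone k P a x -> 0 < P.@[x].
Proof.
move=> [Pa _] [lam lamE lam0].
have <- : (fun i => 0 * a i + x i) = x by apply/funext => i; rewrite mul0r add0r.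
by rewrite lamE mulr_gt0 // prodr_gt0 // => j _; rewrite add0r.
Qed.

Section Cone.
Variable e : 'I_n -> R.
Hypothesis P_hyp : hyperbolic P e.

Let cone x := hyp_cone k P e x.
Let coneP x := hyp_coneP x P_hyp.

Lemma hyp_cone_segment_to_direction y r : 0 <= r <= 1 -> cone y ->
  cone (fun i => e i + r * (y i - e i)).
Proof.
move=> /andP[r0 r1] /coneP ynz; apply/coneP => t t0.
have [->|nr0] := eqVneq r 0.
  apply: (@homog_scale_neq0 _ _ _ _ (t + 1) e _ P_homog); last by rewrite gt_eqF ?P_hyp.1.
    by rewrite gt_eqF // ltr_wpDl.
  by move=> i; ring.
apply: (homog_scale_neq0 P_homog nr0 _ (ynz ((t + 1 - r) / r) _)).
  by move=> i; field.
by rewrite divr_ge0 // subr_ge0 (le_trans r1) // lerDr.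
Qed.

(** The inverse of [1 + sum 1 / lam_j] is a value of [eps] below all the
    eigenvalues. *)
Lemma hyp_cone_shrink x : cone x ->
  exists2 eps : R, 0 < eps & cone (fun i => x i - eps * e i).
Proof.
move=> [lam lamE lam0]; pose s := 1 + \sum_j (lam j)^-1.
have sj j : (lam j)^-1 < s.
  rewrite /s (bigD1 j) //= addrCA ltrDl ltr_pwDl // sumr_ge0 // => l _.
  by rewrite invr_ge0 ltW.
have s0 : 0 < s by rewrite ltr_pwDl // sumr_ge0 // => l _; rewrite invr_ge0 ltW.
exists s^-1; first by rewrite invr_gt0.
exists (fun j => lam j - s^-1) => [t|j].
  transitivity (P.@[fun i => (t - s^-1) * e i + x i]).
    by congr (_.@[_]); apply/funext => i; ring.
  by rewrite lamE; congr (_ * _); apply: eq_bigr => j _; rewrite [RHS]addrA [RHS]addrAC.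
by rewrite subr_gt0 -[lam j]invrK ltf_pV2 // posrE invr_gt0.
Qed.

(** Root confinement in [t] for the family with [r * x] in place of [x].  There is
    no real root since [e] is a direction of hyperbolicity.  At [r = 0], a root
    [s] would make [z = i / s] a root of [P (z e + b)], hence a negative number,
    and [s] would be in the lower half-plane. *)
Lemma upper_half_plane_sum_neq0 b x (t : C) : cone b -> 0 <= complex.Im t ->
  Pc.@[fun i => t * (b i)%:C + ('i%C * (e i)%:C + (x i)%:C)] != 0.
Proof.
move=> bcone; have Pb : Pc.@[fun i => (b i)%:C] != 0.
  rewrite complexification_real; apply/eqP => -[] /eqP.
  by rewrite gt_eqF // (hyp_cone_gt0 P_hyp).
have noreal (r s : R) :
    Pc.@[fun i => s%:C * (b i)%:C + ('i%C * (e i)%:C + r%:C * (x i)%:C)] != 0.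
  apply/eqP => Peq0; suff : (1 : R) == 0 by rewrite oner_eq0.
  apply/eqP/(P_hyp.2 (fun i => s * b i + r * x i) 'i%C).
  rewrite -/Pc -[RHS]Peq0; congr (_.@[_]); apply/funext => i.
  by rewrite rmorphD !rmorphM /=; ring.
have start (s : C) : 0 <= complex.Im s ->
    Pc.@[fun i => s * (b i)%:C + ('i%C * (e i)%:C + 0%:C * (x i)%:C)] != 0.
  have [-> _|s_neq0 s0] := eqVneq s 0; first exact: noreal.
  apply/eqP => Peq0; pose z := 'i%C / s.
  have zP : Pc.@[fun i => z * (e i)%:C + (b i)%:C] = 0.
    apply/eqP/negPn/negP => zP; suff /eqP : Pc.@[fun i => s * (b i)%:C +
      ('i%C * (e i)%:C + 0%:C * (x i)%:C)] != 0 by rewrite Peq0.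
    apply: (homog_scale_neq0 complexification_homog s_neq0 _ zP) => i.
    by rewrite /z mul0r addr0; field.
  have zIm := P_hyp.2 _ _ zP; pose r := complex.Re z.
  have zr : z = r%:C by rewrite /r; case: z zIm {zP r} => ? ? /= ->.
  have r0 : r <= 0.
    rewrite leNgt; apply/negP => r0; move/coneP: bcone => /(_ r (ltW r0)) /eqP[].
    apply: (@complexI R); rewrite -complexification_real -[RHS]zP zr.
    by congr (_.@[_]); apply/funext => i; rewrite rmorphD rmorphM.
  have : complex.Im (z * s) = 1 by rewrite /z divfK.
  rewrite zr; case: (s) s0 => u v /= v0; rewrite mul0r addr0.
  by move=> rv; have := mulr_le0_ge0 r0 v0; rewrite rv ler10.
move=> t0; have := @roots_stay_in_lower_half_plane R n k Pc (fun i => (b i)%:C)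
  (fun i => 'i%C * (e i)%:C) (fun i => (x i)%:C) complexification_homog Pb
  (fun r s _ => noreal r s) start t t0.
by congr (_.@[_] != 0); apply/funext => i; rewrite mul1r.
Qed.

(** With [b - eps e] in place of [b], the term [i e] of the previous lemma restores
    the missing part of [i b], up to a homothety of ratio [eps]. *)
Lemma tube_neq0 b x : cone b -> Pc.@[fun i => 'i%C * (b i)%:C + (x i)%:C] != 0.
Proof.
move=> /hyp_cone_shrink[eps eps0 bcone].
pose c : C := (eps^-1)%:C.
have c0 : c != 0 by rewrite (inj_eq (@complexI R) _ 0) invr_eq0 gt_eqF.
have Imc : 0 <= complex.Im (c * 'i%C).
  by rewrite /= !(mul0r, mulr0, mulr1, addr0) invr_ge0 ltW.
apply: (homog_scale_neq0 complexification_homog (invr_neq0 c0) _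
  (upper_half_plane_sum_neq0 (fun i => eps^-1 * x i) bcone Imc)) => i.
apply: (mulfI c0); rewrite mulVKf //.
have ce : c * eps%:C = 1 by rewrite /c -rmorphM mulVf ?gt_eqF.
rewrite rmorphB !rmorphM /= -/c.
have -> : c * ('i%C * (b i)%:C + (x i)%:C) =
  c * 'i%C * ((b i)%:C - eps%:C * (e i)%:C) + (c * eps%:C) * 'i%C * (e i)%:C + c * (x i)%:C by ring.
by rewrite ce mul1r addrA.
Qed.

(** A zero of [P (z b + x)] with [Im z <> 0] would be, up to a homothety of ratio
    [Im z], a zero in the tube. *)
Lemma hyperbolic_cone b : cone b -> hyperbolic P b.
Proof.
move=> bcone; split=> [|x z Pz]; first exact: hyp_cone_gt0 bcone.
apply/eqP/negPn/negP => z0; pose tau := complex.Im z.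
have tauC0 : tau%:C != 0 by rewrite (inj_eq (@complexI R) _ 0).
suff /eqP : Pc.@[fun i => z * (b i)%:C + (x i)%:C] != 0 by [].
apply: (homog_scale_neq0 complexification_homog tauC0 _
  (tube_neq0 (fun i => tau^-1 * (complex.Re z * b i + x i)) bcone)) => i.
rewrite {1}[z]complexE -/tau !rmorphM rmorphD rmorphM /=.
have tt : tau%:C * (tau^-1)%:C = 1 by rewrite -rmorphM mulfV.
by rewrite mulrDr (mulrA tau%:C (tau^-1)%:C) tt; ring.
Qed.

(** Root confinement in [t] for [P (t x + i ((1 - r) e + r y))]: real roots are
    excluded by the non-vanishing on the tube, and [t = i s] is in the upper
    half-plane. *)
Lemma hyp_cone_segment_neq0 x y s : cone x -> cone y -> 0 <= s ->
  P.@[fun i => s * x i + y i] != 0.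
Proof.
move=> xcone ycone s0.
have Px : Pc.@[fun i => (x i)%:C] != 0.
  rewrite complexification_real; apply/eqP => -[] /eqP.
  by rewrite gt_eqF // (hyp_cone_gt0 P_hyp).
have s0' : 0 <= complex.Im (s%:C * 'i%C) by rewrite /= mulr1 mul0r addr0.
have := @roots_stay_in_lower_half_plane R n k Pc (fun i => (x i)%:C)
  (fun i => 'i%C * (e i)%:C) (fun i => 'i%C * (y i - e i)%:C)
  complexification_homog Px _ _ _ s0'.
move=> /(_ _ _) Pneq0.
have {Pneq0} : Pc.@[fun i => 'i%C * (s * x i + y i)%:C] != 0.
  rewrite (_ : (fun i => _) = fun i => s%:C * 'i%C * (x i)%:C +
     ('i%C * (e i)%:C + 1%:C * ('i%C * (y i - e i)%:C))).
    apply: Pneq0 => [r t r01 | t t0].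
      rewrite (_ : (fun i => _) = fun i => 'i%C * (e i + r * (y i - e i))%:C + (t * x i)%:C).
        exact/tube_neq0/hyp_cone_segment_to_direction.
      by apply/funext => i; rewrite rmorphD !rmorphM /=; ring.
    have := upper_half_plane_sum_neq0 (fun=> 0) xcone t0.
    by congr (_.@[_] != 0); apply/funext => i; rewrite mul0r.
  by apply/funext => i; rewrite rmorphD rmorphM rmorphB /= mul1r; ring.
apply: contra => /eqP Peq0; apply/eqP.
rewrite (homog_scale complexification_homog (fun i => erefl)).
by rewrite complexification_real Peq0 mulr0.
Qed.

Lemma hyp_cone_add x y s : cone x -> cone y -> 0 <= s ->
  cone (fun i => s * x i + y i).
Proof.
move=> xcone ycone s0; apply/coneP => t t0.
have := hyp_cone_segment_neq0 xcone (y := fun i => t * e i + y i) _ s0.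
rewrite (_ : (fun i => t * e i + (s * x i + y i)) =
             (fun i => s * x i + (t * e i + y i))).
  apply; apply/coneP => r r0; move/coneP: ycone => /(_ (r + t) (addr_ge0 r0 t0)).
  by congr (_.@[_] != 0); apply/funext => i; ring.
by apply/funext => i; ring.
Qed.

Lemma hyp_cone_scale x c : cone x -> 0 < c -> cone (fun i => c * x i).
Proof.
move=> /coneP xcone c0; apply/coneP => t t0.
have c_neq0 : c != 0 by rewrite gt_eqF.
apply: (homog_scale_neq0 P_homog c_neq0 _ (xcone (t / c) (divr_ge0 t0 (ltW c0)))).
by move=> i; field.
Qed.

(** Along the segment, [P] is [P x] times the product of the [s + (1 - s) mu_j],
    where the [mu_j] are the eigenvalues of [y] with respect to [x] and have
    product [P y / P x >= 1]. *)
Lemma hyp_cone_quasiconcave x y s : cone x -> cone y -> 0 < s < 1 ->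
  P.@[x] <= P.@[y] -> P.@[x] <= P.@[fun i => s * x i + (1 - s) * y i].
Proof.
move=> xcone ycone /andP[s0 s1] Pxy.
have Px := hyp_cone_gt0 P_hyp xcone.
have xhyp := hyperbolic_cone xcone.
have [mu muE mu0] : hyp_cone k P x y.
  by apply/(hyp_coneP y xhyp) => t t0; apply: hyp_cone_segment_neq0.
have t0 : 0 < 1 - s by rewrite subr_gt0.
rewrite [leRHS](@homog_scale _ _ _ _ (1 - s) (fun i => s / (1 - s) * x i + y i) _ P_homog).
  rewrite muE mulrCA ler_peMr ?(ltW Px) //.
  rewrite -[k in _ ^+ k]card_ord -prodr_const -big_split /=.
  under eq_bigr => j _ do rewrite mulrDr mulrCA divff ?gt_eqF // mulr1.
  have := @prod_affine_ge1 _ s (1 - s) [seq mu j | j <- index_enum 'I_k].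
  rewrite !big_map /=; apply; rewrite ?(ltW s0) ?(ltW t0) //; first by ring.
    by apply/allP => _ /mapP[j _ ->].
  move: Pxy; have {1}<- : (fun i => 0 * x i + y i) = y by apply/funext => i; ring.
  rewrite muE ler_pMr //; suff -> : \prod_j (0 + mu j) = \prod_j mu j by [].
  by apply: eq_bigr => j _; rewrite add0r.
by move=> i; field; rewrite gt_eqF.
Qed.

Lemma superlevel_convex x y c s : 0 <= s <= 1 ->
  cone x -> cone y -> c <= P.@[x] -> c <= P.@[y] ->
  cone (fun i => s * x i + (1 - s) * y i) /\
  c <= P.@[fun i => s * x i + (1 - s) * y i].
Proof.
move=> /andP[s0 s1] xcone ycone cx cy.
have [->|s_neq0] := eqVneq s 0.
  by rewrite (_ : (fun i => _) = y) //; apply/funext => i; ring.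
have [->|s_neq1] := eqVneq s 1.
  by rewrite (_ : (fun i => _) = x) //; apply/funext => i; ring.
have {}s0 : 0 < s by rewrite lt_def s_neq0.
have {}s1 : s < 1 by rewrite lt_def eq_sym s_neq1.
have t0 : 0 < 1 - s by rewrite subr_gt0.
split; first by apply: hyp_cone_add (ltW s0) => //; apply: hyp_cone_scale.
have [xy|/ltW yx] := leP P.@[x] P.@[y].
  by apply: le_trans cx _; apply: hyp_cone_quasiconcave; rewrite ?s0.
apply: le_trans cy _.
rewrite (_ : (fun i => _) = fun i => (1 - s) * y i + (1 - (1 - s)) * x i).
  by apply: hyp_cone_quasiconcave => //; apply/andP; split; lra.
by apply/funext => i; ring.
Qed.
End Cone.
End Hyperbolic.

(** * Bistochastic matrices *)

Lemma double_card_imset (T U : finType) (f : T -> U) (F : {set T}) :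
  (forall p, p \in F -> exists q, [/\ q \in F, q != p & f q = f p]) ->
  (2 * #|f @: F| <= #|F|)%N.
Proof.
move=> Ftwin; rewrite -[#|F|]sum1_card (partition_big_imset f) /=.
rewrite mulnC -sum_nat_const; apply: leq_sum => _ /imsetP[p pF ->].
rewrite sum1dep_card; have [q [qF qp fqp]] := Ftwin p pF.
by apply/card_gt1P; exists p, q; rewrite !inE pF qF fqp !eqxx eq_sym.
Qed.

Lemma underdetermined_system (K : fieldType) (T E : finType) (F : {set T})
    (B : {set E}) (c : T -> E -> K) : (#|B| < #|F|)%N ->
  exists v : T -> K, [/\ forall p, p \notin F -> v p = 0, exists p, v p != 0
    & forall e, e \in B -> \sum_p v p * c p e = 0].
Proof.
move=> ltBF; pose M := \matrix_(a < #|F|, b < #|B|) c (enum_val a) (enum_val b).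
have ker0 : kermx M != 0.
  rewrite -mxrank_eq0 mxrank_ker -lt0n subn_gt0.
  exact: leq_ltn_trans (rank_leq_col _) ltBF.
have [w wM w0] : exists2 w : 'rV_#|F|, w *m M = 0 & w != 0.
  by case/rowV0Pn: ker0 => w /sub_kermxP; exists w.
pose v p := \sum_a w 0 a * (enum_val a == p)%:R.
have vE a : v (enum_val a) = w 0 a.
  rewrite /v (bigD1 a) //= eqxx mulr1 big1 ?addr0 // => b ba.
  by rewrite (inj_eq enum_val_inj) (negbTE ba) mulr0.
exists v; split.
- move=> p pF; rewrite /v big1 // => a _; rewrite (_ : _ == p = false) ?mulr0 //.
  by apply: contraNF pF => /eqP <-; apply: enum_valP.
- have /rV0Pn[a wa] := w0; by exists (enum_val a); rewrite vE.
move=> e eB; transitivity ((w *m M) 0 (enum_rank_in eB e)); last by rewrite wM mxE.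
rewrite mxE; under eq_bigr do rewrite /v big_distrl /=.
rewrite exchange_big /=; apply: eq_bigr => a _.
rewrite mxE enum_rankK_in // (bigD1 (enum_val a)) //= eqxx mulr1 big1 ?addr0 // => p pa.
by rewrite eq_sym (negbTE pa) mulr0 mul0r.
Qed.

Section Birkhoff.
Variables (R : realFieldType) (n : nat).
Implicit Types (S D : 'M[R]_n) (y : 'I_n -> R).

Definition bistochastic S := [/\ forall i j, 0 <= S i j,
  forall i, \sum_j S i j = 1 & forall j, \sum_i S i j = 1].

Definition balanced D := (forall i, \sum_j D i j = 0) /\ (forall j, \sum_i D i j = 0).

Definition fractional S := [set p : 'I_n * 'I_n | (S p.1 p.2 != 0) && (S p.1 p.2 != 1)].

Definition nonzeros S := [set p : 'I_n * 'I_n | S p.1 p.2 != 0].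

Lemma fractional_twin (I : finType) (a : I -> R) (j : I) :
  (forall i, 0 <= a i) -> \sum_i a i = 1 -> a j != 0 -> a j != 1 ->
  exists2 l, l != j & (a l != 0) && (a l != 1).
Proof.
move=> a0 a1 aj0 aj1; have [/existsP[l /andP[lj al0]]|] := boolP [exists l, (l != j) && (a l != 0)].
  exists l => //; rewrite al0 /=; apply: contra aj0 => /eqP al1.
  have jl : j != l by rewrite eq_sym.
  move: a1; rewrite (bigD1 l) //= (bigD1 j) //= al1 => /eqP.
  rewrite addrC -subr_eq0 addrK paddr_eq0 ?a0 ?sumr_ge0 // => /andP[] //.
move=> /existsPn none; case/negP: aj1; rewrite -a1 (bigD1 j) //= big1 ?addr0 // => l lj.
by have := none l; rewrite lj /= negbK => /eqP.
Qed.

(** Every row or column that contains a fractional entry contains two of them.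
    So the number of fractional entries is at least the number of rows and
    columns that they meet, while the conditions that these rows and columns
    have sum zero are dependent. *)
Lemma balanced_direction S : bistochastic S -> fractional S != finset.set0 ->
  exists D, [/\ D != 0, balanced D & forall i j, S i j = 0 -> D i j = 0].
Proof.
move=> [S0 S1 S2] /set0Pn[p0 p0F]; set F := fractional S in p0F *.
have rows : (2 * #|fst @: F| <= #|F|)%N.
  apply: double_card_imset => -[i j]; rewrite inE /= => /andP[].
  move=> /(fractional_twin (S0 i) (S1 i)) H /H [l lj al].
  by exists (i, l); rewrite inE /= al xpair_eqE eqxx.
have cols : (2 * #|snd @: F| <= #|F|)%N.
  apply: double_card_imset => -[i j]; rewrite inE /= => /andP[].
  move=> /(fractional_twin (fun i => S0 i j) (S2 j)) H /H [l lj al].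
  by exists (l, j); rewrite inE /= al xpair_eqE eqxx andbT.
(* The column of [p0] is left out: the sum of its entries follows from the other
   conditions, as the rows and the columns have the same total. *)
pose B : {set 'I_n + 'I_n} := inl @: (fst @: F) :|: inr @: (snd @: F :\ p0.2).
have ltBF : (#|B| < #|F|)%N.
  apply: leq_ltn_trans (leq_card_setU _ _) _; rewrite (card_imset _ inl_inj) (card_imset _ inr_inj).
  have := cardsD1 p0.2 (snd @: F); rewrite imset_f //; lia.
have [v [vF [q vq] vB]] := underdetermined_system
  (fun p e => match e with inl i => (p.1 == i)%:R | inr j => (p.2 == j)%:R end : R) ltBF.
pose D := \matrix_(i, j) v (i, j).
have rowE i : \sum_p v p * (p.1 == i)%:R = \sum_j D i j.
  rewrite (eq_bigr (fun p : 'I_n * 'I_n => v (p.1, p.2) * (p.1 == i)%:R)); last by case.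
  rewrite -(pair_bigA _ (fun a j => v (a, j) * (a == i)%:R)) /= (bigD1 i) //=.
  rewrite [X in _ + X]big1 ?addr0.
    by apply: eq_bigr => j _; rewrite eqxx mulr1 mxE.
  by move=> l li; apply: big1 => j _; rewrite (negbTE li) mulr0.
have colE j : \sum_p v p * (p.2 == j)%:R = \sum_i D i j.
  rewrite (eq_bigr (fun p : 'I_n * 'I_n => v (p.1, p.2) * (p.2 == j)%:R)); last by case.
  rewrite -(pair_bigA _ (fun a l => v (a, l) * (l == j)%:R)) /=.
  apply: eq_bigr => i _; rewrite (bigD1 j) //= eqxx mulr1 mxE big1 ?addr0 //.
  by move=> l li; rewrite (negbTE li) mulr0.
have row0 i : \sum_j D i j = 0.
  have [iF|iF] := boolP (i \in fst @: F).
    by rewrite -rowE (vB (inl i)) // inE imset_f.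
  by apply: big1 => j _; rewrite mxE vF //; apply: contra iF => /(imset_f fst).
have colne j : j != p0.2 -> \sum_i D i j = 0.
  move=> jp; have [jF|jF] := boolP (j \in snd @: F).
    by rewrite -colE (vB (inr j)) // inE [X in _ || X]imset_f ?orbT // !inE jp.
  by apply: big1 => i _; rewrite mxE vF //; apply: contra jF => /(imset_f snd).
have col0 j : \sum_i D i j = 0.
  have [->|/colne //] := eqVneq j p0.2.
  have : \sum_j \sum_i D i j = 0 by rewrite exchange_big big1.
  by rewrite (bigD1 p0.2) //= [X in _ + X]big1 ?addr0.
exists D; split=> //.
  by apply: contra vq => /eqP/matrixP/(_ q.1 q.2); rewrite !mxE -surjective_pairing => ->.
by move=> i j Sij; rewrite mxE vF // inE /= Sij eqxx.
Qed.

Lemma balancedN D : balanced D -> balanced (- D).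
Proof.
by move=> [r c]; split=> i; under eq_bigr do rewrite mxE; rewrite sumrN ?r ?c oppr0.
Qed.

(** Moving along [D] until the first entry vanishes: [eps] is the least ratio
    [S p / - D p] over the negative entries of [D]. *)
Lemma bistochastic_move S D : bistochastic S -> balanced D -> D != 0 ->
  (forall i j, S i j = 0 -> D i j = 0) ->
  exists2 eps, 0 < eps & bistochastic (S + eps *: D) /\
    (#|nonzeros (S + eps *: D)%R| < #|nonzeros S|)%N.
Proof.
move=> [S0 S1 S2] [D1 D2] Dnz SD.
have [p0 p0neg] : exists p : 'I_n * 'I_n, D p.1 p.2 < 0.
  apply/existsP; apply: contraNT Dnz => /existsPn Dge.
  have {}Dge i j : 0 <= D i j by have := Dge (i, j); rewrite -leNgt.
  apply/eqP/matrixP => i j; rewrite mxE; apply/eqP.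
  have /eqP := D1 i; rewrite psumr_eq0 // => /allP /(_ j); rewrite mem_index_enum.
  by apply.
pose ratio (p : 'I_n * 'I_n) := S p.1 p.2 / - D p.1 p.2.
have [p pneg pmin] :=
  Order.TotalTheory.arg_minP (P := fun q => D q.1 q.2 < 0) ratio p0neg.
have Spos q : D q.1 q.2 < 0 -> 0 < S q.1 q.2.
  move=> Dq; rewrite lt_def S0 andbT; apply: contraTN Dq => /eqP /SD ->.
  by rewrite ltxx.
exists (ratio p); first by rewrite divr_gt0 ?Spos ?oppr_gt0.
split.
  split=> [i j|i|j].
  - rewrite !mxE; have [Dij|Dij] := leP 0 (D i j).
      by rewrite addr_ge0 // mulr_ge0 // divr_ge0 // oppr_ge0 ltW.
    have := pmin (i, j) Dij; rewrite {2}/ratio /= ler_pdivlMr ?oppr_gt0 //.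
    by rewrite mulrN; lra.
  - by under eq_bigr do rewrite !mxE; rewrite big_split /= S1 -big_distrr /= D1 mulr0 addr0.
  - by under eq_bigr do rewrite !mxE; rewrite big_split /= S2 -big_distrr /= D2 mulr0 addr0.
apply: proper_card; apply/properP; split.
  apply/fintype.subsetP => q; rewrite !inE; apply: contra => /eqP Sq.
  by rewrite !mxE Sq SD // mulr0 addr0.
exists p; rewrite !inE; first by rewrite gt_eqF ?Spos.
by rewrite !mxE /ratio invrN mulrN mulNr divfK ?subrr ?eqxx ?lt_eqF.
Qed.

Lemma permutation_of_integral S : bistochastic S -> fractional S = finset.set0 ->
  exists s : 'S_n, forall i j, S i j = (j == s i)%:R.
Proof.
move=> [S0 S1 S2] F0.
have int i j : S i j != 0 -> S i j = 1.
  move=> Sij; apply/eqP/negPn/negP => Sij1.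
  by have := finset.in_set0 (i, j); rewrite -F0 inE /= Sij Sij1.
have ex i : exists j, S i j == 1.
  apply/existsP; apply: contraT => /existsPn none.
  have /eqP := S1 i; rewrite big1 ?(eq_sym 0) ?oner_eq0 // => j _.
  by apply/eqP; apply: contraT => /int/eqP; rewrite (negbTE (none j)).
pose f i := xchoose (ex i); have fP i : S i (f i) = 1 by apply/eqP/(xchooseP (ex i)).
have alone (a : 'I_n -> R) i l : (forall j, 0 <= a j) -> \sum_j a j = 1 ->
    a i = 1 -> l != i -> a l = 0.
  move=> a0 a1 ai li; move: a1; rewrite (bigD1 i) //= (bigD1 l) //= ai => /eqP.
  rewrite addrC -subr_eq0 addrK paddr_eq0 ?a0 ?sumr_ge0 // => /andP[/eqP] //.
have finj : injective f.
  move=> i l fil; apply/eqP/negPn/negP => il.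
  have := alone (fun i => S i (f l)) l i (fun i => S0 i _) (S2 _) (fP l) il.
  by rewrite -fil fP => /eqP; rewrite oner_eq0.
exists (perm finj) => i j; rewrite permE.
by have [->|ji] := eqVneq j (f i); rewrite ?fP // (alone _ (f i)).
Qed.

(** Birkhoff's theorem, for sets rather than as a decomposition.  Unless [S] is a
    permutation matrix, it lies between two bistochastic matrices with fewer
    nonzero entries, obtained by moving along [D] and along [- D]. *)
Lemma bistochastic_image_mem (V : ('I_n -> R) -> Prop) y S :
  (forall s : 'S_n, V (fun i => y (s i))) ->
  (forall x z s, 0 <= s <= 1 -> V x -> V z -> V (fun i => s * x i + (1 - s) * z i)) ->
  bistochastic S -> V (fun i => \sum_j S i j * y j).
Proof.
move=> Vperm Vconv; have [m] := ubnP #|nonzeros S|.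
elim: m S => // m IHm S ltm Sbi.
have [F0|Fn0] := eqVneq (fractional S) finset.set0.
  have [s sE] := permutation_of_integral Sbi F0.
  rewrite (_ : (fun i => _) = fun i => y (s i)) //; apply/funext => i.
  rewrite (bigD1 (s i)) //= sE eqxx mul1r big1 ?addr0 // => j js.
  by rewrite sE (negbTE js) mul0r.
have [D [Dnz Dbal SD]] := balanced_direction Sbi Fn0.
have [e1 e10 [S1bi lt1]] := bistochastic_move Sbi Dbal Dnz SD.
have [||e2 e20 [S2bi lt2]] := bistochastic_move Sbi (balancedN Dbal).
- by rewrite oppr_eq0.
- by move=> i j /SD; rewrite mxE => ->; rewrite oppr0.
have e0 : 0 < e1 + e2 by rewrite addr_gt0.
have s01 : 0 <= e2 / (e1 + e2) <= 1.
  by rewrite divr_ge0 ?(ltW e20) ?(ltW e0) //= ler_pdivrMr // mul1r lerDr ltW.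
have := Vconv _ _ _ s01 (IHm _ (leq_trans lt1 ltm) S1bi) (IHm _ (leq_trans lt2 ltm) S2bi).
rewrite (_ : (fun i => _ + _) = fun i => \sum_j S i j * y j) //; apply/funext => i.
rewrite !mulr_sumr -big_split /=; apply: eq_bigr => j _; rewrite !mxE.
by field; rewrite gt_eqF.
Qed.

End Birkhoff.

(** * Diagonals of normal matrices *)

Lemma char_poly_conj_diag (C : fieldType) (n : nat) (U : 'M[C]_n) (sp : 'rV_n) :
  U \in unitmx -> char_poly (invmx U *m diag_mx sp *m U) = \prod_i ('X - (sp 0 i)%:P).
Proof.
move=> Uu; pose Up := map_mx polyC U; pose Vp := map_mx polyC (invmx U).
have VU : Vp *m Up = 1%:M by rewrite -map_mxM mulVmx // map_mx1.
rewrite /char_poly /char_poly_mx.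
have -> : 'X%:M - map_mx polyC (invmx U *m diag_mx sp *m U) =
    Vp *m ('X%:M - map_mx polyC (diag_mx sp)) *m Up.
  rewrite mulmxBr mulmxBl -!map_mxM; congr (_ - _).
  by rewrite scalar_mxC -mulmxA VU mulmx1.
rewrite !det_mulmx mulrAC -det_mulmx VU det1 mul1r.
transitivity (char_poly (diag_mx sp)) => //.
rewrite char_poly_trig ?diag_mx_is_trig //.
by apply: eq_bigr => i _; rewrite mxE eqxx.
Qed.

(** The weights are the squared moduli of the entries of a diagonalizing unitary
    matrix; the permutation [s] matches its order of the eigenvalues with the
    order in [lam]. *)
Lemma normal_diagonal_bistochastic (R : rcfType) (n : nat) (A : 'M[R[i]]_n)
    (lam : 'I_n -> R[i]) :
  A \is normalmx -> char_poly A = \prod_(i < n) ('X - (lam i)%:P) ->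
  exists2 S : 'M[R]_n, bistochastic S &
    forall i, complex.Re (A i i) = \sum_j S i j * complex.Re (lam j).
Proof.
move=> /orthomx_spectralP AE; set U := spectralmx A in AE; set sp := spectral_diag A in AE.
have Uunit : U \in unitmx by apply: spectral_unit.
have Uuni : U \is unitarymx by apply: spectral_unitarymx.
rewrite {1}AE char_poly_conj_diag // => spE.
have [s lamE] : exists s : 'S_n, forall i, lam i = sp 0 (s i).
  have : perm_eq [tuple lam i | i < n] [tuple sp 0 i | i < n].
    apply: prod_XsubC_eq; rewrite !big_tuple; under eq_bigr do rewrite tnth_mktuple.
    by under [RHS]eq_bigr do rewrite tnth_mktuple.
  case/tuple_permP => s sE; exists s => i.
  have := congr1 (fun t => nth 0 t i) sE.
  by rewrite -!tnth_nth !tnth_mktuple.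
pose S := \matrix_(i, j) complex.Re (`|U (s j) i| ^+ 2).
have norm_real (z : R[i]) : `|z| ^+ 2 \is Num.real by rewrite realX ?normr_real.
have Sreal i j : (S i j)%:C = U (s j) i * (U (s j) i)^*%C.
  by rewrite mxE RRe_real // sqr_normc.
have VE i j : invmx U i j = (U j i)^*%C by rewrite invmx_unitary // !mxE.
exists S.
  split=> [i j|i|j]; first by rewrite mxE -ler0c RRe_real // exprn_ge0.
    apply: (@complexI R); rewrite (rmorph_sum (real_complex R)) /=.
    transitivity ((invmx U *m U) i i); last by rewrite mulVmx // mxE eqxx.
    rewrite mxE [RHS](reindex_inj (@perm_inj _ s)) /=; apply: eq_bigr => j _.
    by rewrite Sreal mulrC -VE.
  apply: (@complexI R); rewrite (rmorph_sum (real_complex R)) /=.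
  transitivity ((U *m invmx U) (s j) (s j)); last by rewrite mulmxV // mxE eqxx.
  by rewrite mxE; apply: eq_bigr => i _; rewrite Sreal -VE.
move=> i; have -> : A i i = \sum_j (S i j)%:C * lam j.
  rewrite {1}AE mxE (reindex_inj (@perm_inj _ s)) /=; apply: eq_bigr => j _.
  rewrite Sreal -VE lamE mul_mx_diag mxE; ring.
rewrite (raddf_sum (@complex.Re R : {additive R[i] -> R})); apply: eq_bigr => j _.
by case: (lam j) => u v /=; rewrite mul0r subr0.
Qed.

(** * The theorem *)

Theorem corollary3p3 (R : realType) (n k : nat) (P : {mpoly R[n]})
    (P_homog : P \is k.-homog)
    (P_sym : symmetric_poly P)
    (P_hyp : hyperbolic P (@ones R n))
    (A : 'M[R[i]]_n) (A_normal : A \is normalmx)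
    (lam : 'I_n -> R[i]) (lam_eig : mx_eigenvalues A lam)
    (lam_cone : hyp_cone k P (@ones R n) (fun i => complex.Re (lam i))) :
  hyp_cone k P (@ones R n) (fun i => complex.Re (A i i)) /\
  P.@[fun i => complex.Re (lam i)] <= P.@[fun i => complex.Re (A i i)].
Proof.
have [S S_bi dE] := normal_diagonal_bistochastic A_normal lam_eig.
have -> : (fun i => complex.Re (A i i)) =
  fun i => \sum_j S i j * complex.Re (lam j) by apply/funext.
pose V x := hyp_cone k P (@ones R n) x /\ P.@[fun i => complex.Re (lam i)] <= P.@[x].
apply: (@bistochastic_image_mem _ _ V) => // [s|x z s s01 [xcone xge] [zcone zge]].
  split; last by rewrite (P_sym s (fun i => complex.Re (lam i))).
  have [mu muE mu0] := lam_cone; exists mu => // t.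
  by rewrite -muE -[RHS](P_sym s).
exact: (superlevel_convex P_homog P_hyp s01 xcone zcone xge zge).
Qed.
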